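(* Let $A\in\mathbb{R}^{m\times n}$, $b\in\mathbb{R}^m$ with $Ax=b$ consistent and $x^*$ satisfying $Ax^*=b$, and let $B\in\mathbb{R}^{n\times n}$ be symmetric positive definite. Let $S$ be a complete discrete sampling with $S=S_i\in\mathbb{R}^{m\times q_i}$ with probability $$p_i=\frac{\mathrm{Tr}(S_i^\top AB^{-1}A^\top S_i)}{\|B^{-1/2}A^\top\mathbf{S}\|_F^2},\qquad i=1,\dots,r.$$ Starting from $x^0\in\mathbb{R}^n$, let $x^{k+1}=x^k-B^{-1}A^\top S(S^\top AB^{-1}A^\top S)^\dagger S^\top(Ax^k-b)$, where in each iteration $S$ is a fresh independent copy of the sampling. Then for all $k\ge 0$ $$\mathbf{E}\left[\|x^k-x^*\|_B^2\right]\le\rho_c^k\,\|x^0-x^*\|_B^2,\qquad \rho_c=1-\frac{\lambda_{\min}\left(\mathbf{S}^\top AB^{-1}A^\top\mathbf{S}\right)}{\|B^{-1/2}A^\top\mathbf{S}\|_F^2}.$$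
   Context: A random matrix $S$ is a complete discrete sampling if $S=S_i\in\mathbb{R}^{m\times q_i}$ with probability $p_i>0$, $i=1,\dots,r$, $\sum_{i=1}^r p_i=1$, where each $S_i^\top A$ has full row rank, and the concatenation $\mathbf{S}=[S_1,\dots,S_r]\in\mathbb{R}^{m\times\sum_i q_i}$ is such that $A^\top\mathbf{S}$ has full row rank. $\|\cdot\|_F$ is the Frobenius norm, $\|x\|_B=\sqrt{x^\top Bx}$, $\lambda_{\min}$ is the smallest eigenvalue, $\dagger$ is the Moore–Penrose pseudoinverse, $B^{-1/2}$ is the symmetric positive definite square root of $B^{-1}$. The starting point $x^0$ is deterministic. *)

(* Defs.v *)
From HB Require Import structures.
From mathcomp Require Import all_boot all_order all_algebra finmap.
From mathcomp Require Import all_classical all_reals all_analysis.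

Set Implicit Arguments.
Unset Strict Implicit.
Unset Printing Implicit Defensive.

Import Order.TTheory GRing.Theory Num.Theory.

Local Open Scope classical_set_scope.
Local Open Scope ring_scope.

Section MatrixNotions.
Context {R : realType}.

Definition spdmx n (B : 'M[R]_n) : Prop :=
  B^T = B /\ forall x : 'cV[R]_n, x != 0 -> 0 < (x^T *m B *m x) 0 0.

Definition Bnorm n (B : 'M[R]_n) (x : 'cV[R]_n) : R :=
  Num.sqrt ((x^T *m B *m x) 0 0).

Definition frobenius m n (M : 'M[R]_(m, n)) : R :=
  Num.sqrt (\sum_i \sum_j M i j ^+ 2).

(* The symmetric positive definite C with C^2 = B^-1. It exists and is unique *)
(* when B is symmetric positive definite; the default 0 is junk otherwise.    *)
Definition inv_sqrtmx n (B : 'M[R]_n) : 'M[R]_n :=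
  xget 0 [set C | spdmx C /\ C *m C = invmx B].

(* The four Penrose equations, which determine X uniquely. *)
Definition is_mpinv m n (M : 'M[R]_(m, n)) (X : 'M[R]_(n, m)) : Prop :=
  [/\ M *m X *m M = M, X *m M *m X = X,
      (M *m X)^T = M *m X & (X *m M)^T = X *m M].

(* MathComp's pinvmx is only a partial inverse, not the Moore-Penrose one. *)
Definition mpinv m n (M : 'M[R]_(m, n)) : 'M[R]_(n, m) :=
  xget 0 [set X | is_mpinv M X].

(* Only meaningful when M has a real eigenvalue, e.g. M symmetric of positive *)
(* size: the set is then finite and nonempty and the infimum is its minimum.  *)
Definition lambda_min n (M : 'M[R]_n) : R := inf [set a | eigenvalue M a].

End MatrixNotions.

Section Sampling.
Context {R : realType} (m n r : nat) (q : 'I_r -> nat).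

Definition complete_discrete_sampling (A : 'M[R]_(m, n))
    (S : forall i : 'I_r, 'M[R]_(m, q i)) (p : 'I_r -> R) : Prop :=
  [/\ forall i, 0 < p i, \sum_i p i = 1,
      forall i, row_free ((S i)^T *m A)
    & row_free (A^T *m \mxrow_i S i)].

End Sampling.

Definition sketch_project_step {R : realType} m n q (A : 'M[R]_(m, n))
    (b : 'cV[R]_m) (B : 'M[R]_n) (S : 'M[R]_(m, q)) (x : 'cV[R]_n) : 'cV[R]_n :=
  x - invmx B *m A^T *m S *m mpinv (S^T *m A *m invmx B *m A^T *m S)
        *m S^T *m (A *m x - b).

(* s k is the index of the matrix drawn at iteration k. *)
Fixpoint sketch_project_iter {R : realType} m n r (q : 'I_r -> nat)
    (A : 'M[R]_(m, n)) (b : 'cV[R]_m) (B : 'M[R]_n)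
    (S : forall i : 'I_r, 'M[R]_(m, q i)) (x0 : 'cV[R]_n)
    (s : nat -> 'I_r) (k : nat) : 'cV[R]_n :=
  if k is k'.+1 then
    sketch_project_step A b B (S (s k')) (sketch_project_iter A b B S x0 s k')
  else x0.

Section IndependentCopies.
Context d (T : measurableType d) (R : realType) (P : probability T R).

(* For families with values in a finite set V, carrying the discrete          *)
(* sigma-algebra, so that U k ranges over all subsets of V.                   *)
Definition mutually_independent (I : choiceType) (V : finType)
    (X : I -> T -> V) : Prop :=
  forall (J : {fset I}) (U : I -> set V),
    P (\bigcap_(k in [set` J]) (X k @^-1` U k))
    = (\prod_(k <- J) P (X k @^-1` U k))%E.

(* As the S_i have different sizes, a random matrix equal to S_i with         *)
(* probability p_i is represented by its random index.                        *)
Definition iid_sampling r (p : 'I_r -> R) (idx : nat -> T -> 'I_r) : Prop :=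
  [/\ forall k i, measurable (idx k @^-1` [set i]),
      forall k i, P (idx k @^-1` [set i]) = (p i)%:E
    & mutually_independent idx].

End IndependentCopies.

(* Main.v *)
(* Write e = x - x*, G_i = S_i^T A B^-1 A^T S_i and y_i = S_i^T A e. A step    *)
(* with S_i decreases |e|_B^2 by exactly y_i^T G_i^-1 y_i, which is at least  *)
(* |y_i|^2 / Tr G_i. The choice of p_i cancels Tr G_i, so that the expected   *)
(* decrease is at least |S^T A e|^2 / F^2 for the concatenation S. Since      *)
(* A^T S has full row rank, B e = A^T S u for some u; with G = S^T A B^-1 A^T *)
(* S this reads |S^T A e|^2 = |G u|^2 >= lambda_min(G) u^T G u =              *)
(* lambda_min(G) |e|_B^2. Only the appearance of the same F^2 in p_i and in   *)
(* rho_c matters, not its value. The one-step contraction is iterated by      *)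
(* conditioning on the first draw.                                            *)
Require Import Defs.
From HB Require Import structures.
From mathcomp Require Import all_boot all_order all_algebra finmap.
From mathcomp Require Import all_classical all_reals all_analysis.
From mathcomp Require Import ring lra.

Set Implicit Arguments.
Unset Strict Implicit.
Unset Printing Implicit Defensive.

Import Order.TTheory GRing.Theory Num.Theory.

Local Open Scope classical_set_scope.
Local Open Scope ring_scope.

(** A step projects the iterate [B]-orthogonally onto the solutions of the sketched system, so
    Pythagoras gives its exact error decrease ([sketch_project_step_sqr]). A trace bound
    ([sketch_decrease_ge]), averaged with weights proportional to the traces, reassembles the
    residual of the concatenated sketch, which dominates the error up to the smallest eigenvalue
    ([lambda_min_sketch_le]). This yields [sketch_project_contract], which [expectation_orbit_le]
    iterates for any nonnegative potential that contracts on average. The spectral facts are derived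
    without diagonalization, from Cauchy-Schwarz for semidefinite forms. *)

Section LinearAlgebra.
Context {R : realType}.

(** * Positive semidefinite forms and trace bounds *)

Definition dot n (x y : 'cV[R]_n) : R := (x^T *m y) 0 0.

Lemma dotE n (x y : 'cV[R]_n) : dot x y = \sum_i x i 0 * y i 0.
Proof. by rewrite /dot mxE; apply: eq_bigr => i _; rewrite mxE. Qed.

Lemma dotC n (x y : 'cV[R]_n) : dot x y = dot y x.
Proof. by rewrite !dotE; apply: eq_bigr => i _; rewrite mulrC. Qed.

Lemma dotBr n (x y z : 'cV[R]_n) : dot x (y - z) = dot x y - dot x z.
Proof. by rewrite /dot mulmxBr !mxE. Qed.

Lemma dotBl n (x y z : 'cV[R]_n) : dot (y - z) x = dot y x - dot z x.
Proof. by rewrite dotC dotBr !(dotC x). Qed.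

Lemma dotZr n a (x y : 'cV[R]_n) : dot x (a *: y) = a * dot x y.
Proof. by rewrite /dot -scalemxAr mxE. Qed.

Lemma dotZl n a (x y : 'cV[R]_n) : dot (a *: x) y = a * dot x y.
Proof. by rewrite dotC dotZr dotC. Qed.

Lemma dot0 n (x : 'cV[R]_n) : dot x 0 = 0.
Proof. by rewrite /dot mulmx0 mxE. Qed.

Lemma dot_mulmx m n (M : 'M[R]_(m, n)) x y : dot x (M *m y) = dot (M^T *m x) y.
Proof. by rewrite /dot trmx_mul trmxK mulmxA. Qed.

Lemma dot_ge0 n (x : 'cV[R]_n) : 0 <= dot x x.
Proof. by rewrite dotE; apply: sumr_ge0 => i _; rewrite -expr2 sqr_ge0. Qed.

Lemma dot_eq0 n (x : 'cV[R]_n) : (dot x x == 0) = (x == 0).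
Proof.
apply/eqP/eqP => [|->]; last by rewrite dot0.
rewrite dotE => /eqP; rewrite psumr_eq0 => [/allP x0|i _]; last first.
  by rewrite -expr2 sqr_ge0.
apply/colP => i; rewrite mxE; have := x0 i (mem_index_enum _).
by rewrite mulf_eq0 orbb => /eqP.
Qed.

Definition psdmx n (M : 'M[R]_n) : Prop :=
  M^T = M /\ forall x : 'cV[R]_n, 0 <= dot x (M *m x).

Lemma spdmx_psd n (M : 'M[R]_n) : spdmx M -> psdmx M.
Proof.
move=> [symM posM]; split=> // x; have [->|/posM] := eqVneq x 0.
  by rewrite mulmx0 dot0.
by rewrite /dot mulmxA => /ltW.
Qed.

Lemma psdmx_congr m n (M : 'M[R]_n) (K : 'M[R]_(n, m)) :
  psdmx M -> psdmx (K^T *m M *m K).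
Proof.
move=> [symM posM]; split; first by rewrite !trmx_mul trmxK symM mulmxA.
by move=> x; rewrite -!mulmxA dot_mulmx trmxK.
Qed.

Lemma psdmx1 n : psdmx (1%:M : 'M[R]_n).
Proof. by split=> [|x]; rewrite ?trmx1 // mul1mx dot_ge0. Qed.

Lemma psdmx_cauchy_schwarz n (M : 'M[R]_n) (x y : 'cV[R]_n) : psdmx M ->
  dot x (M *m y) ^+ 2 <= dot x (M *m x) * dot y (M *m y).
Proof.
move=> [symM posM].
have symd u v : dot u (M *m v) = dot v (M *m u) by rewrite dot_mulmx symM dotC.
have quad s t : 0 <= s ^+ 2 * dot x (M *m x) - 2 * s * t * dot x (M *m y)
                      + t ^+ 2 * dot y (M *m y).
  have := posM (s *: x - t *: y).
  rewrite mulmxBr -!scalemxAr !(dotBl, dotBr, dotZl, dotZr) (symd y x).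
  by congr (_ <= _); ring.
have := posM y; rewrite le0r => /orP[/eqP yy0|yy_gt0].
  (* When [y] is isotropic, these values of [s] and [t] make the quadratic a negative multiple of
     [dot x (M *m y) ^+ 2], so the cross term vanishes. *)
  have := quad (dot x (M *m y)) (dot x (M *m x) + 1).
  have := posM x; rewrite yy0 => xx_ge0; nra.
(* The minimizing ratio of [s] to [t]: the quadratic becomes [dot y (M *m y)] times the gap in
   Cauchy-Schwarz. *)
have := quad (dot y (M *m y)) (dot x (M *m y)); nra.
Qed.

(** Cauchy-Schwarz in the form of [M] against the basis vector [e_j] bounds the square of the [j]-th
    entry of [M z] by [M j j] times [z^T M z]; summing over [j] produces the trace. *)
Lemma psdmx_sqr_le_tr n (M : 'M[R]_n) (z : 'cV[R]_n) : psdmx M ->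
  dot (M *m z) (M *m z) <= \tr M * dot z (M *m z).
Proof.
move=> psdM; rewrite dotE mulr_suml; apply: ler_sum => j _.
pose e : 'cV[R]_n := delta_mx j 0.
have dote y : dot e y = y j 0.
  rewrite dotE (bigD1 j)//= big1 ?addr0 => [|i /negbTE ij].
    by rewrite !mxE !eqxx mul1r.
  by rewrite !mxE ij mul0r.
have := psdmx_cauchy_schwarz e z psdM.
by rewrite !dote /e -colE [col _ _ _ _]mxE.
Qed.

Lemma psdmx_tr_ge0 n (M : 'M[R]_n) : psdmx M -> 0 <= \tr M.
Proof.
move=> [_ posM]; apply: sumr_ge0 => j _.
have := posM (delta_mx j 0); rewrite -colE dotE (bigD1 j)//= big1 => [|i /negbTE ij].
  by rewrite !mxE !eqxx mul1r addr0.
by rewrite !mxE ij mul0r.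
Qed.

Lemma psdmx_le_tr n (M : 'M[R]_n) (z : 'cV[R]_n) : psdmx M ->
  dot z (M *m z) <= \tr M * dot z z.
Proof.
move=> psdM; have := psdmx_sqr_le_tr z psdM.
have := psdmx_cauchy_schwarz z (M *m z) (psdmx1 n); rewrite !mul1mx.
have := psdmx_tr_ge0 psdM; have := psdM.2 z; have := dot_ge0 z.
set a := dot z _; set c := \tr _; set b := dot z (_ *m _); set e := dot _ _.
move=> a0 b0 c0 h1 h2.
(* Euclidean Cauchy-Schwarz for [z] and [M z], followed by the previous trace bound; cancelling [b]
   then gives the claim. *)
have h3 : b * b <= b * (c * a).
  by apply: le_trans (_ : a * e <= _); [rewrite -expr2|nra].
move: b0; rewrite le0r => /orP[/eqP ->|b_gt0]; first exact: mulr_ge0.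
by move: h3; rewrite ler_pM2l.
Qed.

Lemma psdmx_unit_coercive n (M : 'M[R]_n) : psdmx M -> M \in unitmx ->
  exists2 c, 0 < c & forall z : 'cV[R]_n, c * dot z z <= dot z (M *m z).
Proof.
move=> psdM uM; pose K := invmx M.
(* With [z = K (M z)], the two trace bounds give [|z|^2 <= tr (K^T K) |M z|^2 <= tr (K^T K) tr M z^T
   M z]. Adding 1 keeps [s] positive even in dimension 0. *)
pose s := \tr (K^T *m 1%:M *m K) * \tr M + 1.
have psdK := psdmx_congr K (psdmx1 n).
have s_gt0 : 0 < s by rewrite ltr_wpDl// mulr_ge0// psdmx_tr_ge0.
exists s^-1 => [|z]; first by rewrite invr_gt0.
rewrite ler_pdivrMl//.
have := psdmx_le_tr (M *m z) psdK.
rewrite -!mulmxA dot_mulmx trmxK mul1mx /K mulKmx// !mulmxA -/K => /le_trans; apply.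
apply: le_trans (ler_wpM2l (psdmx_tr_ge0 psdK) (psdmx_sqr_le_tr z psdM)) _.
by rewrite mulrA /s mulrDl mul1r lerDl psdM.2.
Qed.

(** * The smallest eigenvalue as a lower bound *)

Lemma eigenvalue_psdmx_ge0 n (M : 'M[R]_n) a : psdmx M -> eigenvalue M a -> 0 <= a.
Proof.
move=> [symM posM] /eigenvalueP[v vM v0].
have := posM v^T; rewrite -[M in M *m _]symM -trmx_mul vM linearZ/= dotZr pmulr_lge0//.
by rewrite lt0r dot_ge0 dot_eq0 trmx_eq0 v0.
Qed.

Lemma lambda_min_psdmx_ge0 n (M : 'M[R]_n) : psdmx M -> 0 <= lambda_min M.
Proof.
move=> psdM; rewrite /lambda_min; set E := [set _ | _].
(* In dimension 0 the spectrum is empty and the infimum takes its default value 0. *)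
have [->|/set0P E0] := eqVneq E set0; first by rewrite inf0.
by apply: lb_le_inf => // a /eigenvalue_psdmx_ge0; exact.
Qed.

(* The largest t with M >= t I is an eigenvalue: otherwise M - t I would be   *)
(* invertible, hence coercive, and t could be increased.                      *)
Lemma lambda_min_le n (M : 'M[R]_n) (z : 'cV[R]_n) : psdmx M ->
  lambda_min M * dot z z <= dot z (M *m z).
Proof.
move=> psdM; have [symM posM] := psdM.
have [->|z0] := eqVneq z 0; first by rewrite mulmx0 !dot0 mulr0.
have zz_gt0 : 0 < dot z z by rewrite lt0r dot_ge0 dot_eq0 z0.
pose E := [set t : R | forall y : 'cV[R]_n, t * dot y y <= dot y (M *m y)].
have E0 : E 0 by move=> y; rewrite mul0r.
have ubE : has_ubound E.
  by exists (dot z (M *m z) / dot z z) => t /(_ z); rewrite ler_pdivlMr.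
have Esup : E (sup E).
  move=> y; have [->|y0] := eqVneq y 0; first by rewrite mulmx0 !dot0 mulr0.
  have yy_gt0 : 0 < dot y y by rewrite lt0r dot_ge0 dot_eq0 y0.
  rewrite -ler_pdivlMr//; apply: ge_sup; first by exists 0.
  by move=> t /(_ y); rewrite ler_pdivlMr.
have [Nunit|Nsing] := boolP (M - (sup E)%:M \in unitmx).
  have psdN : psdmx (M - (sup E)%:M).
    split; first by rewrite linearB/= symM tr_scalar_mx.
    by move=> y; rewrite mulmxBl mul_scalar_mx dotBr dotZr subr_ge0.
  have [c c_gt0 hc] := psdmx_unit_coercive psdN Nunit.
  have : E (sup E + c).
    move=> y; have := hc y; rewrite mulmxBl mul_scalar_mx dotBr dotZr; lra.
  by move=> /(ub_le_sup ubE); lra.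
have supEig : eigenvalue M (sup E).
  by rewrite /eigenvalue /eigenspace kermx_eq0 row_free_unit.
apply: le_trans (Esup z); rewrite ler_pM2r//; apply: ge_inf => //.
by exists 0 => a /eigenvalue_psdmx_ge0; exact.
Qed.

(** Expanding [|M u - l u|^2 >= 0] with [l] the smallest eigenvalue gives
    [|M u|^2 >= 2 l u^T M u - l^2 |u|^2], and [l^2 |u|^2 <= l u^T M u] because [l >= 0]. *)
Lemma lambda_min_le_sqr n (M : 'M[R]_n) (u : 'cV[R]_n) : psdmx M ->
  lambda_min M * dot u (M *m u) <= dot (M *m u) (M *m u).
Proof.
move=> psdM; have := dot_ge0 (M *m u - lambda_min M *: u).
have := ler_wpM2l (lambda_min_psdmx_ge0 psdM) (lambda_min_le u psdM).
rewrite !(dotBl, dotBr, dotZl, dotZr) (dotC (M *m u) u); lra.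
Qed.

(** * Positive definite matrices and the pseudoinverse *)

Lemma spdmx_unit n (M : 'M[R]_n) : spdmx M -> M \in unitmx.
Proof.
move=> [_ posM]; rewrite -row_free_unit; apply: inj_row_free => v vM.
apply/eqP; apply: contraT => v0.
by have := posM v^T; rewrite trmx_eq0 trmxK vM mul0mx mxE ltxx => /(_ v0).
Qed.

Lemma spdmx_inv n (M : 'M[R]_n) : spdmx M -> spdmx (invmx M).
Proof.
move=> spdM; have uM := spdmx_unit spdM; have [symM posM] := spdM.
split=> [|x x0]; first by rewrite trmx_inv symM.
have := posM (invmx M *m x); rewrite trmx_mul trmx_inv symM -mulmxA mulKVmx//.
apply; apply: contraNneq x0 => Mx0; apply/eqP.
by rewrite -(mulKVmx uM x) Mx0 mulmx0.
Qed.

Lemma spdmx_congr m n (M : 'M[R]_n) (K : 'M[R]_(m, n)) :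
  spdmx M -> row_free K -> spdmx (K *m M *m K^T).
Proof.
move=> [symM posM] freeK; split=> [|x x0].
  by rewrite !trmx_mul trmxK symM mulmxA.
have := posM (K^T *m x); rewrite trmx_mul trmxK !mulmxA; apply.
apply: contraNneq x0 => Kx0; rewrite -trmx_eq0; apply/eqP.
by apply: (row_free_inj freeK); rewrite mul0mx -[K]trmxK -trmx_mul Kx0 trmx0.
Qed.

Lemma mpinv_unit n (M : 'M[R]_n) : M \in unitmx -> mpinv M = invmx M.
Proof.
move=> uM; have := @xgetPex _ 0 [set X | is_mpinv M X].
rewrite -/(mpinv M); case; first exists (invmx M).
  by split; rewrite ?mulmxV ?mulVmx ?mul1mx ?trmx1.
set X := mpinv M => MXM _ _ _.
by rewrite -[LHS](mulKmx uM) -[M *m X](mulmxK uM) MXM mulmxV// mulmx1.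
Qed.

Lemma Bnorm_sqr n (B : 'M[R]_n) (x : 'cV[R]_n) :
  psdmx B -> Bnorm B x ^+ 2 = dot x (B *m x).
Proof. by move=> [_ posB]; rewrite /Bnorm -mulmxA sqr_sqrtr ?posB. Qed.

End LinearAlgebra.
(* The first of the k steps is applied first, unlike in sketch_project_iter:  *)
(* this allows conditioning on the first draw.                                *)
Fixpoint orbit_from (I X : Type) (f : I -> X -> X) (x : X) (s : nat -> I)
    (a k : nat) : X :=
  if k is k'.+1 then orbit_from f (f (s a) x) s a.+1 k' else x.

Lemma orbit_fromSr (I X : Type) (f : I -> X -> X) x (s : nat -> I) a k :
  orbit_from f x s a k.+1 = f (s (a + k)%N) (orbit_from f x s a k).
Proof.
elim: k a x => [|k IHk] a x; first by rewrite /= addn0.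
by rewrite -[LHS]/(orbit_from f _ s a.+1 k.+1) IHk addSnnS.
Qed.

(** * Expected decay along an orbit driven by independent draws *)

Section RandomOrbit.
Context d (T : measurableType d) (R : realType) (P : probability T R).
Context (r : nat) (p : 'I_r -> R) (idx : nat -> T -> 'I_r).
Hypothesis idx_iid : iid_sampling P p idx.
Context (X : Type) (f : 'I_r -> X -> X).

Lemma measurable_idx_preimage k (U : set 'I_r) : measurable (idx k @^-1` U).
Proof.
have [midx _ _] := idx_iid.
rewrite [X in measurable X](_ : _ = \bigcup_(i in U) (idx k @^-1` [set i])).
  by apply: fin_bigcup_measurable => // i _; exact: midx.
by apply/seteqP; split=> [w Uw|w [i Ui /= ->]] //; exists (idx k w).
Qed.

(** Only finitely many draws, each with finitely many values, are involved; hence [Y] may be any set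
    and [X] carries no sigma-algebra. *)
Lemma measurable_orbit_preimage x a k (Y : set X) :
  measurable [set w | Y (orbit_from f x (idx ^~ w) a k)].
Proof.
elim: k a x => [|k IHk] a x /=.
  have [Yx|Yx] := pselect (Y x).
    by rewrite [X in measurable X](_ : _ = setT)//; apply/seteqP; split.
  by rewrite [X in measurable X](_ : _ = set0)//; apply/seteqP; split.
rewrite [X in measurable X](_ : _ = \bigcup_(i in [set: 'I_r])
    (idx a @^-1` [set i] `&`
     [set w | Y (orbit_from f (f i x) (idx ^~ w) a.+1 k)])).
  apply: fin_bigcup_measurable => // i _.
  by apply: measurableI => //; exact: measurable_idx_preimage.
by apply/seteqP; split=> [w Yw|w [i _ [/= -> ]]] //; exists (idx a w).
Qed.

Let cylinder (J : {fset nat}) (U : nat -> set 'I_r) : set T :=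
  \bigcap_(j in [set` J]) (idx j @^-1` U j).

Let measurable_cylinder J U : measurable (cylinder J U).
Proof.
by apply: bigcap_measurableType => j _; exact: measurable_idx_preimage.
Qed.

(** Prescribing one more draw multiplies the probability by [p i]: mutual independence is applied to
    [J] and to [J] enlarged by [a]. *)
Let cylinder_next J U a i : a \notin J ->
  let U' j := if j == a then [set i] else U j in
  cylinder (a |` J)%fset U' = cylinder J U `&` idx a @^-1` [set i] /\
  P (cylinder (a |` J)%fset U') = (P (cylinder J U) * (p i)%:E)%E.
Proof.
move=> aJ U'; have [_ Pidx indep] := idx_iid.
have U'J j : j \in J -> U' j = U j.
  by move=> jJ; rewrite /U'; case: eqP => // ja; rewrite -ja jJ in aJ.
have U'a : U' a = [set i] by rewrite /U' eqxx.
split; last first.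
  rewrite /cylinder !indep big_fsetU1//= U'a Pidx muleC; congr (_ * _)%E.
  rewrite big_seq [RHS]big_seq; apply: eq_bigr => j jJ.
  by rewrite U'J.
apply/seteqP; split=> [w Cw|w [Cw aw] j].
  split; last by have := Cw a; rewrite /= U'a; apply; rewrite fset1U1.
  by move=> j /= jJ; rewrite -U'J//; apply: Cw; rewrite /= fset1Ur.
by rewrite /= in_fset1U => /predU1P[->|jJ]; rewrite ?U'a// U'J//; exact: Cw.
Qed.

Context (phi : X -> R) (rho : R).
Hypothesis phi_ge0 : forall x, 0 <= phi x.
Hypothesis rho_ge0 : 0 <= rho.
Hypothesis contract : forall x, \sum_i p i * phi (f i x) <= rho * phi x.

(** Integrating over events about draws before [a] replaces conditional expectation: fixing draw [a]
    to [i] yields another such event for [a.+1], to which the induction hypothesis applies. *)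
Let integral_orbit_le J U a k x : (forall j, j \in J -> (j < a)%N) ->
  (\int[P]_(w in cylinder J U) (phi (orbit_from f x (idx ^~ w) a k))%:E
   <= (rho ^+ k * phi x)%:E * P (cylinder J U))%E.
Proof.
elim: k a x J U => [|k IHk] a x J U Ja.
  by rewrite /= expr0 mul1r (integral_cst _ (measurable_cylinder _ _)).
have aJ : a \notin J by apply/negP => /Ja; rewrite ltnn.
pose D i := cylinder J U `&` idx a @^-1` [set i].
have CE : cylinder J U = \big[setU/set0]_(i <- index_enum 'I_r) D i.
  rewrite -bigcup_seq; apply/seteqP; split=> [w Cw|w [i _ []]] //.
  by exists (idx a w) => //=; exact: mem_index_enum.
rewrite {1}CE ge0_integral_bigsetU//=.
- apply: (@le_trans _ _ (\sum_i (rho ^+ k * phi (f i x))%:E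
                              * (P (cylinder J U) * (p i)%:E))%E).
    apply: lee_sum => i _.
    have [DE PD] := cylinder_next U i aJ.
    rewrite -PD /D -DE.
    apply: le_trans (IHk a.+1 (f i x) _ _ _); last first.
      by move=> j; rewrite in_fset1U => /predU1P[->//|/Ja /ltnW].
    rewrite le_eqVlt; apply/orP; left; apply/eqP.
    by apply: eq_integral => w; rewrite inE DE => -[_ /= ->].
  have Cfin : P (cylinder J U) \is a fin_num by exact: fin_num_measure.
  rewrite -(fineK Cfin).
  under eq_bigr do rewrite -!EFinM.
  rewrite sumEFin lee_fin.
  (* Once the common nonnegative factor is pulled out, the remaining sum is the left-hand side of
     [contract]. *)
  rewrite [leLHS](_ : _ = rho ^+ k * fine (P (cylinder J U))
                         * (\sum_i p i * phi (f i x))); last first.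
    by rewrite mulr_sumr; apply: eq_bigr => i _; ring.
  rewrite [leRHS](_ : _ = rho ^+ k * fine (P (cylinder J U)) * (rho * phi x)).
    by apply: ler_wpM2l => //; rewrite mulr_ge0 ?exprn_ge0 ?fine_ge0.
  by rewrite exprSr; ring.
- by move=> i; apply: measurableI => //; exact: measurable_idx_preimage.
- by rewrite /index_enum -enumT enum_uniq.
- by move=> i j _ _ [w [[_ /= <-] [_ /= <-]]].
- rewrite -CE => mC Z mZ; apply: measurableI => //.
  exact: (measurable_orbit_preimage x a k.+1 [set y | Z (phi y)%:E]).
- by move=> w _; rewrite lee_fin.
Qed.

Lemma expectation_orbit_le k x :
  ('E_P[fun w => phi (orbit_from f x (idx ^~ w) 0 k)]
   <= (rho ^+ k * phi x)%:E)%E.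
Proof.
have := @integral_orbit_le fset0 (fun=> setT) 0%N k x.
have -> : cylinder fset0 (fun=> setT) = setT by apply/seteqP; split.
by rewrite probability_setT mule1 unlock; apply.
Qed.

End RandomOrbit.

(** * Contraction of one sketch-and-project step *)

Section SketchProject.
Context {R : realType} (m n : nat) (A : 'M[R]_(m, n)) (B : 'M[R]_n).
Hypothesis spdB : spdmx B.

Definition sketch_gram q (S : 'M[R]_(m, q)) : 'M[R]_q :=
  S^T *m A *m invmx B *m A^T *m S.

Lemma sketch_gramE q (S : 'M[R]_(m, q)) :
  sketch_gram S = (S^T *m A) *m invmx B *m (S^T *m A)^T.
Proof. by rewrite trmx_mul trmxK /sketch_gram !mulmxA. Qed.

Lemma psdmx_sketch_gram q (S : 'M[R]_(m, q)) : psdmx (sketch_gram S).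
Proof.
rewrite sketch_gramE -[X in X *m invmx B]trmxK.
exact/psdmx_congr/spdmx_psd/spdmx_inv.
Qed.

(** Full row rank makes the Gram matrix [G] invertible, so the pseudoinverse is its inverse. With
    [z = G^-1 y], the cross term is [-2 y^T z] and the squared correction is [z^T G z = y^T z]. *)
Lemma sketch_project_step_sqr q (S : 'M[R]_(m, q)) (x xstar : 'cV[R]_n) :
  row_free (S^T *m A) ->
  let y := S^T *m A *m (x - xstar) in
  Bnorm B (sketch_project_step A (A *m xstar) B S x - xstar) ^+ 2 =
  Bnorm B (x - xstar) ^+ 2 - dot y (invmx (sketch_gram S) *m y).
Proof.
move=> freeS y; have uB := spdmx_unit spdB.
have psdB := spdmx_psd spdB.
have uW : sketch_gram S \in unitmx.
  by rewrite sketch_gramE; exact/spdmx_unit/spdmx_congr/freeS/spdmx_inv.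
rewrite !Bnorm_sqr// /sketch_project_step -/(sketch_gram S) mpinv_unit//.
rewrite -mulmxBr addrAC.
set e := x - xstar in y *; clearbody e; set z := invmx (sketch_gram S) *m y.
have -> : invmx B *m A^T *m S *m invmx (sketch_gram S) *m S^T *m (A *m e) =
          invmx B *m ((S^T *m A)^T *m z).
  by rewrite /z /y trmx_mul trmxK -!mulmxA.
rewrite mulmxBr mulKVmx// !(dotBl, dotBr).
rewrite [dot (invmx B *m _) (B *m e)]dot_mulmx psdB.1 mulKVmx//.
rewrite (dotC e (_ *m z)) (dotC (invmx B *m _)) -!dot_mulmx -/y.
rewrite (mulmxA _ _ (_ *m z)) (mulmxA _ _ z) -sketch_gramE mulKVmx// (dotC z).
ring.
Qed.

Lemma sketch_decrease_ge q (S : 'M[R]_(m, q)) (y : 'cV[R]_q) :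
  row_free (S^T *m A) ->
  dot y y <= \tr (sketch_gram S) * dot y (invmx (sketch_gram S) *m y).
Proof.
move=> freeS; have uW : sketch_gram S \in unitmx.
  by rewrite sketch_gramE; exact/spdmx_unit/spdmx_congr/freeS/spdmx_inv.
have := psdmx_sqr_le_tr (invmx (sketch_gram S) *m y) (psdmx_sketch_gram S).
by rewrite mulKVmx// (dotC _ y).
Qed.

Lemma lambda_min_sketch_le q (S : 'M[R]_(m, q)) (e : 'cV[R]_n) :
  row_free (A^T *m S) ->
  lambda_min (sketch_gram S) * Bnorm B e ^+ 2 <=
  dot (S^T *m A *m e) (S^T *m A *m e).
Proof.
move=> /row_freeP[Z ASZ]; have uB := spdmx_unit spdB.
(* [Z] is a right inverse of [A^T S], so [u] solves [B e = A^T S u]. *)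
pose u := Z *m B *m e.
have Be : B *m e = A^T *m S *m u by rewrite !mulmxA ASZ mul1mx.
have eE : e = invmx B *m (A^T *m S *m u) by rewrite -Be mulKmx.
have SAe : S^T *m A *m e = sketch_gram S *m u.
  by rewrite [in LHS]eE /sketch_gram !mulmxA.
rewrite Bnorm_sqr; last exact: spdmx_psd.
have := lambda_min_le_sqr u (psdmx_sketch_gram S).
rewrite -SAe; congr (_ * _ <= _).
by rewrite Be [RHS]dot_mulmx trmx_mul trmxK dotC.
Qed.


Lemma sketch_project_contract r (q : 'I_r -> nat)
    (S : forall i : 'I_r, 'M[R]_(m, q i)) (p : 'I_r -> R) (F2 : R)
    (x xstar : 'cV[R]_n) :
  complete_discrete_sampling A S p -> 0 <= F2 ->
  (forall i, p i = \tr (sketch_gram (S i)) / F2) ->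
  \sum_i p i *
    Bnorm B (sketch_project_step A (A *m xstar) B (S i) x - xstar) ^+ 2 <=
  (1 - lambda_min (sketch_gram (\mxrow_i S i)) / F2) *
    Bnorm B (x - xstar) ^+ 2.
Proof.
move=> [_ sum_p freeS freeSS] F2_ge0 pE; set e := x - xstar.
pose y i := (S i)^T *m A *m e.
rewrite (eq_bigr (fun i => p i * Bnorm B e ^+ 2 -
    p i * dot (y i) (invmx (sketch_gram (S i)) *m y i))) => [|i _]; last first.
  by rewrite sketch_project_step_sqr// mulrBr.
rewrite sumrB -mulr_suml sum_p mulrBl !mul1r lerD2l lerN2.
apply: (@le_trans _ _ (F2^-1 * \sum_i dot (y i) (y i))).
  rewrite mulrAC mulrC ler_wpM2l ?invr_ge0//.
  apply: le_trans (lambda_min_sketch_le e freeSS) _.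
  (* The blocks of the concatenated residual are the [y i], so its squared norm is the sum of
     theirs. *)
  rewrite -!mulmxA -dot_mulmx tr_mxrow (mulmxA _ (\mxcol_i _)) mul_mxrow_mxcol.
  rewrite mulmx_suml /dot mulmx_sumr summxE le_eqVlt; apply/orP; left; apply/eqP.
  apply: eq_bigr => i _; rewrite -[RHS]/(dot (y i) (y i)) /y -!(mulmxA _ A e).
  by rewrite -dot_mulmx /dot !mulmxA.
rewrite mulr_sumr; apply: ler_sum => i _.
by rewrite pE mulrAC [leRHS]mulrC ler_wpM2l ?invr_ge0// sketch_decrease_ge.
Qed.

End SketchProject.

Lemma sketch_project_iterE {R : realType} m n r (q : 'I_r -> nat)
    (A : 'M[R]_(m, n)) b (B : 'M[R]_n) (S : forall i : 'I_r, 'M[R]_(m, q i))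
    x0 s k :
  sketch_project_iter A b B S x0 s k =
  orbit_from (fun i => sketch_project_step A b B (S i)) x0 s 0 k.
Proof. by elim: k => [//|k IHk]; rewrite orbit_fromSr add0n -IHk. Qed.

Theorem theorem19 (R : realType) (m n : nat)
    (A : 'M[R]_(m, n)) (b : 'cV[R]_m) (xstar : 'cV[R]_n)
    (Axstar : A *m xstar = b)
    (B : 'M[R]_n) (Bspd : spdmx B)
    (r : nat) (q : 'I_r -> nat) (S : forall i : 'I_r, 'M[R]_(m, q i))
    (p : 'I_r -> R)
    (Scomplete : complete_discrete_sampling A S p)
    (pE : forall i, p i =
       \tr ((S i)^T *m A *m invmx B *m A^T *m S i)
       / frobenius (inv_sqrtmx B *m A^T *m \mxrow_i S i) ^+ 2)
    (d : measure_display) (T : measurableType d) (P : probability T R)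
    (idx : nat -> T -> 'I_r) (idx_iid : iid_sampling P p idx)
    (x0 : 'cV[R]_n) (k : nat) :
  let x (k : nat) (w : T) : 'cV[R]_n :=
    sketch_project_iter A b B S x0 (fun j => idx j w) k in
  let rho_c : R :=
    1 - lambda_min ((\mxrow_i S i)^T *m A *m invmx B *m A^T *m \mxrow_i S i)
        / frobenius (inv_sqrtmx B *m A^T *m \mxrow_i S i) ^+ 2 in
  ('E_P[fun w => (Bnorm B (x k w - xstar) ^+ 2)%R]
   <= (rho_c ^+ k * Bnorm B (x0 - xstar) ^+ 2)%:E)%E.
Proof.
cbv zeta; set rho_c := (X in X ^+ k); have [p_gt0 _ _ _] := Scomplete.
pose f i := sketch_project_step A b B (S i).
pose phi y := Bnorm B (y - xstar) ^+ 2.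
have phi_ge0 y : 0 <= phi y by exact: sqr_ge0.
have contract y : \sum_i p i * phi (f i y) <= rho_c * phi y.
  rewrite /phi /f -Axstar.
  exact: sketch_project_contract Scomplete (sqr_ge0 _) pE.
have -> : (fun w =>
    Bnorm B (sketch_project_iter A b B S x0 (idx ^~ w) k - xstar) ^+ 2) =
    (fun w => phi (orbit_from f x0 (idx ^~ w) 0 k)).
  by apply/funext => w; rewrite sketch_project_iterE.
(* Iterating the contraction requires a nonnegative factor. A negative [rho_c] would bound a
   nonnegative average by [rho_c * phi y], forcing [phi] to vanish everywhere, so both sides are
   0. *)
have [rho_ge0|rho_lt0] := leP 0 rho_c.
  exact: (expectation_orbit_le idx_iid).
have phi0 y : phi y = 0.
  have : 0 <= rho_c * phi y.
    apply: le_trans (contract y); apply: sumr_ge0 => i _.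
    by rewrite mulr_ge0// ltW.
  by rewrite nmulr_rge0// => phi_le0; apply/le_anti; rewrite phi_le0 phi_ge0.
rewrite -/(phi x0) (phi0 x0) mulr0.
under eq_fun do rewrite phi0.
by rewrite expectation_cst.
Qed.
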